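(* Let $n,m\ge 1$ and let $G=K_n$ be the complete graph on $[n]$, so $d=n+\binom{n}{2}$. Consider any auction with $m$ agents whose valuations $v^1,\dots,v^m$ are graphical valuations with underlying graph $K_n$ (arbitrary real weight vectors $w^1,\dots,w^m\in\mathbb{R}^d$). Then for every bundle $a^*\in\{0,1\}^n$ the auction has a competitive equilibrium at $a^*$ with anonymous graphical pricing, i.e. there exist a price vector $p\in\mathbb{R}^d$ and vectors $a^1,\dots,a^m\in\{0,1\}^d$ with $a^b\in D(v^b,p)$ for all $b\in[m]$ and $\pi\big(\sum_{b=1}^m a^b\big)=a^*$.
   Context: Vectors in $\mathbb{R}^d$, $d=n+|E(G)|$, are indexed by $[n]\sqcup E(G)$ (vertex coordinates $i\in[n]$ first, then edge coordinates $ij\in E(G)$). For $S\subseteq[n]$ let $a_S\in\{0,1\}^d$ be given by $a_{S,i}=1$ iff $i\in S$ and $a_{S,ij}=1$ iff $i,j\in S$ and $ij\in E(G)$. A graphical valuation with underlying graph $G$ and weight vector $w\in\mathbb{R}^d$ is $v(S)=\langle w,a_S\rangle=\sum_{i\in S}w_i+\sum_{ij\in E(G),\,i,j\in S}w_{ij}$. Anonymous graphical pricing: a single vector $p\in\mathbb{R}^d$, the price of bundle $S$ for every agent being $\langle p,a_S\rangle$. The demand set is $D(v,p)=\{a_S: S\in\arg\max_{S\subseteq[n]}(v(S)-\langle p,a_S\rangle)\}$. $\pi:\mathbb{R}^d\to\mathbb{R}^n$ is the projection onto the first $n$ (vertex) coordinates. *)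

(* Defs.v *)
From mathcomp Require Import all_boot all_order all_algebra.
From mathcomp Require Import reals.

Set Implicit Arguments.
Unset Strict Implicit.
Unset Printing Implicit Defensive.

Import Order.TTheory GRing.Theory Num.Theory.
Local Open Scope ring_scope.

(* The edge ij is the two-element set {i, j}. *)
Record graph (n : nat) := Graph {
  edges : {set {set 'I_n}};
  edges_card : forall e, e \in edges -> #|e| = 2
}.

Lemma complete_edges_card (n : nat) (e : {set 'I_n}) :
  e \in [set f : {set 'I_n} | #|f| == 2] -> #|e| = 2.
Proof. by rewrite inE => /eqP. Qed.

Definition complete_graph (n : nat) : graph n :=
  Graph (@complete_edges_card n).

(* The index set [n] + E(G) of the coordinates of R^d. *)
Definition coords (n : nat) (G : graph n) : finType :=
  ('I_n + {e : {set 'I_n} | e \in edges G})%type.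

Definition dot (R : realType) (I : finType) (x y : {ffun I -> R}) : R :=
  \sum_i x i * y i.

Definition zero_one (R : realType) (I : finType) (x : {ffun I -> R}) : Prop :=
  forall i, x i = 0 \/ x i = 1.

(* a_S; an edge e = {i, j} has i, j in S iff e \subset S. *)
Definition bundle_vec (R : realType) (n : nat) (G : graph n)
    (S : {set 'I_n}) : {ffun coords G -> R} :=
  [ffun k : coords G => match k with
    | inl i => i \in S
    | inr e => sval e \subset S
    end%:R].

Definition graphical (R : realType) (n : nat) (G : graph n)
    (v : {set 'I_n} -> R) : Prop :=
  exists w : {ffun coords G -> R}, forall S, v S = dot w (bundle_vec R G S).

Definition utility (R : realType) (n : nat) (G : graph n)
    (v : {set 'I_n} -> R) (p : {ffun coords G -> R}) (S : {set 'I_n}) : R :=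
  v S - dot p (bundle_vec R G S).

(* Membership of a in the demand set D(v, p). *)
Definition demand (R : realType) (n : nat) (G : graph n)
    (v : {set 'I_n} -> R) (p a : {ffun coords G -> R}) : Prop :=
  exists2 S : {set 'I_n},
    (forall T : {set 'I_n}, utility v p T <= utility v p S) &
    a = bundle_vec R G S.

Definition vertex_proj (R : realType) (n : nat) (G : graph n)
    (x : {ffun coords G -> R}) : {ffun 'I_n -> R} :=
  [ffun i => x (inl i)].

(* Competitive equilibrium at astar with anonymous graphical pricing. *)
Definition competitive_equilibrium (R : realType) (n m : nat) (G : graph n)
    (v : 'I_m -> {set 'I_n} -> R) (astar : {ffun 'I_n -> R}) : Prop :=
  exists (p : {ffun coords G -> R}) (a : 'I_m -> {ffun coords G -> R}),
    [/\ forall b, zero_one (a b),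
        forall b, demand (v b) p (a b) &
        vertex_proj (\sum_b a b) = astar].

(* Main.v *)
Require Import Defs.
From mathcomp Require Import all_boot all_order all_algebra.
From mathcomp Require Import reals.
From mathcomp Require Import ring lra.

(* Let S be the bundle encoded by astar. All of S goes to an agent b0 who values
   it most, and everybody else gets nothing. Since all pairs are priced, the
   function T |-> #|T \ S| + #|T :&: S| * #|S \ T|, which is positive except at
   the empty bundle and at S, is a graphical price. Adding a large multiple of
   it to the weights of b0 leaves only these two bundles competitive. *)

Import Order.TTheory GRing.Theory Num.Theory.

Local Open Scope ring_scope.

Lemma natr_bin2 (K : comPzRingType) k : 2 * 'C(k, 2)%:R = k%:R * (k%:R - 1) :> K.
Proof.
elim: k => [|k IHk]; first by rewrite mulr0 mul0r.
by rewrite binS bin1 natrD mulrDr IHk mulrSr; ring.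
Qed.

(** Serves [dot_penalty] with [a], [k], [b] the sizes of [T :\: S], [T :&: S], [S :\: T], so that
    [k + b] is the size of [S]. *)
Lemma natr_bin2_cancel (K : comPzRingType) (a k b : nat) :
  a%:R + k%:R * ((k + b)%:R - 1) + - 2 * 'C(k, 2)%:R = (a + k * b)%:R :> K.
Proof. by rewrite mulNr natr_bin2; ring. Qed.

Section Dot.
Variables (R : realType) (I : finType).
Implicit Types x y z : {ffun I -> R}.

Lemma dotDl x y z : dot (x + y) z = dot x z + dot y z.
Proof. by rewrite /dot -big_split; apply: eq_bigr => i _; rewrite ffunE mulrDl. Qed.

Lemma dotZl c x y : dot [ffun i => c * x i] y = c * dot x y.
Proof. by rewrite /dot mulr_sumr; apply: eq_bigr => i _; rewrite ffunE mulrA. Qed.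

End Dot.

Section Penalty.
Variables (R : realType) (n : nat).
Implicit Types S T : {set 'I_n}.

Lemma zero_one_bundle_vec (G : graph n) S : zero_one (bundle_vec R G S).
Proof.
move=> k; rewrite ffunE.
by case: k => [i|e]; [case: (i \in S) | case: (sval e \subset S)]; auto.
Qed.

Lemma dot_bundle_vec0 (G : graph n) (w : {ffun coords G -> R}) :
  dot w (bundle_vec R G set0) = 0.
Proof.
apply: big1 => -[i|[e eG]] _; rewrite ffunE /= ?inE ?mulr0 //.
by rewrite subset0 -cards_eq0 (edges_card eG) mulr0.
Qed.

(** Inside [S] this is the cut function of the complete graph on [S]: each vertex weighs its degree,
    and an edge with both ends chosen, counted twice by the degrees, is taken off twice. *)
Definition penalty S : {ffun coords (complete_graph n) -> R} :=
  [ffun k : coords (complete_graph n) => match k with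
    | inl i => if i \in S then #|S|%:R - 1 else 1 : R
    | inr e => if sval e \subset S then - 2 else 0 : R
    end].

Lemma dot_penalty S T :
  dot (penalty S) (bundle_vec R (complete_graph n) T) =
  (#|T :\: S| + #|T :&: S| * #|S :\: T|)%:R.
Proof.
have vertices : \sum_i penalty S (inl i) * bundle_vec R (complete_graph n) T (inl i)
    = #|T :\: S|%:R + #|T :&: S|%:R * (#|S|%:R - 1).
  under eq_bigr do rewrite !ffunE.
  move: (#|S|%:R - 1) => c; rewrite -!sum1_card !natr_sum mulr_suml.
  rewrite [X in X + _]big_mkcond [X in _ + X]big_mkcond -big_split /=.
  apply: eq_bigr => i _; rewrite !inE.
  by case: (i \in S); case: (i \in T) => /=; ring.
have pairs : \sum_e penalty S (inr e) * bundle_vec R (complete_graph n) T (inr e)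
    = - 2 * 'C(#|T :&: S|, 2)%:R.
  under eq_bigr do rewrite !ffunE.
  (* The binomial counts the two-element subsets of [T :&: S]; the sum over edges then becomes one
     over all two-element sets. *)
  rewrite -cards_draws.
  rewrite -(big_sub _ (fun e : {set 'I_n} => (if e \subset S then - 2 else 0)
     * (e \subset T)%:R)) /=.
  rewrite -sum1_card natr_sum mulr_sumr big_mkcond [RHS]big_mkcond /=.
  apply: eq_bigr => e _; rewrite !inE subsetI.
  by case: (e \subset S); case: (e \subset T); case: (#|e| == 2) => /=; ring.
rewrite /dot big_sumType vertices pairs -(cardsID T S) (setIC S).
exact: natr_bin2_cancel.
Qed.

Lemma dot_penalty_diag S :
  dot (penalty S) (bundle_vec R (complete_graph n) S) = 0.
Proof. by rewrite dot_penalty setDv cards0 muln0. Qed.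

(** The value is a natural number, so positivity suffices. If [T] is not inside [S] the first
    summand is positive; otherwise [T] and [S :\: T] are both nonempty. *)
Lemma dot_penalty_ge1 S T : T != set0 -> T != S ->
  1 <= dot (penalty S) (bundle_vec R (complete_graph n) T).
Proof.
move=> T0 TS; rewrite dot_penalty ler1n addn_gt0 muln_gt0 !card_gt0 setD_eq0.
case: (boolP (T \subset S)) => //= sTS; rewrite (setIidPl sTS) T0 setD_eq0 /=.
by apply: contra TS => sST; rewrite eqEsubset sTS.
Qed.

End Penalty.

Theorem theorem1p2 (R : realType) (n m : nat) (hn : (1 <= n)%N) (hm : (1 <= m)%N)
    (v : 'I_m -> {set 'I_n} -> R)
    (hv : forall b, graphical (complete_graph n) (v b))
    (astar : {ffun 'I_n -> R}) (hastar : zero_one astar) :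
  competitive_equilibrium (complete_graph n) v astar.
Proof.
pose S := [set i | astar i == 1].
have v0 b : v b set0 = 0 by have [w ->] := hv b; apply: dot_bundle_vec0.
have [b0 _ b0_max] := @arg_maxP _ _ _ (Ordinal hm) predT (fun b => v b S) isT.
have [w vb0E] := hv b0.
pose C := \sum_b \sum_T `|v b T - v b0 T|.
have leC b T : v b T - v b0 T <= C.
  apply: le_trans (ler_norm _) _; rewrite /C (bigD1 b) //= (bigD1 T) //= -addrA.
  by rewrite lerDl addr_ge0 // sumr_ge0 // => ? _; rewrite ?sumr_ge0.
have C_ge0 : 0 <= C by apply: sumr_ge0 => b _; apply: sumr_ge0.
(* The price [w] alone would leave [b0] indifferent between all bundles. *)
pose p := w + [ffun k => C * penalty R n S k].
have utilityE b T : utility (v b) p T =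
    v b T - v b0 T - C * dot (penalty R n S) (bundle_vec R (complete_graph n) T).
  by rewrite /utility dotDl dotZl -vb0E opprD addrA.
(* At [S] the bound is the choice of [b0]; away from [S] and [set0] the penalty is at least 1, so
   [C] absorbs any gain over [b0]. *)
have utility_le0 b T : utility (v b) p T <= 0.
  rewrite utilityE; have [->|T0] := eqVneq T set0.
    by rewrite !v0 dot_bundle_vec0; lra.
  have [->|TS] := eqVneq T S; last first.
    rewrite subr_le0; apply: le_trans (leC b T) _.
    by rewrite ler_peMr // dot_penalty_ge1.
  by rewrite dot_penalty_diag mulr0 subr0 subr_le0; apply: b0_max.
exists p, (fun b => bundle_vec R (complete_graph n) (if b == b0 then S else set0)).
split=> [b|b|]; first exact: zero_one_bundle_vec.
- eexists; last by [].
  (* The bound 0 is attained by [b0] at [S] and by every agent at [set0]. *)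
  move=> T; apply: le_trans (utility_le0 b T) _; rewrite utilityE.
  case: eqP => [->|_]; first by rewrite dot_penalty_diag; lra.
  by rewrite !v0 dot_bundle_vec0; lra.
- apply/ffunP => i; rewrite ffunE sum_ffunE (bigD1 b0) //= big1 => [|b /negPf nb].
    rewrite ffunE eqxx inE addr0.
    by case: (hastar i) => ->; rewrite ?eqxx // eq_sym oner_eq0.
  by rewrite ffunE nb inE.
Qed.
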